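(* (a) A $C^v$-recurrent Finsler manifold is Riemannian. (b) A $C^0$-recurrent Finsler manifold is Riemannian.
   Context: Setting. $M$ is a smooth manifold of finite dimension $n$, $\pi:\mathcal{T}M\to M$ is the bundle of nonzero tangent vectors, $\pi^{-1}(TM)\to\mathcal{T}M$ is the pullback of $TM$ by $\pi$, and $\mathfrak{X}(\pi(M))$ is the module of its smooth sections ($\pi$-vector fields, written $\overline{X}$). Tensor fields on the bundle $\pi^{-1}(TM)$ are called $\pi$-tensor fields; a $\pi$-form of order $p$ is a $\pi$-tensor field of type $(0,p)$. $\overline{\eta}(u)=(u,u)$ is the fundamental $\pi$-vector field. $\rho:T(\mathcal{T}M)\to\pi^{-1}(TM)$ is $\rho=(\pi_{\mathcal{T}M},d\pi)$ and $\gamma:\pi^{-1}(TM)\to V(\mathcal{T}M)$ is the natural isomorphism (vertical lift) onto the vertical bundle. $(M,L)$ is a Finsler manifold ($L$ positively homogeneous of degree $1$, smooth on $\mathcal{T}M$, with positive definite metric $g$ on $\pi^{-1}(TM)$ of components $g_{ij}=\frac12\partial^2L^2/\partial y^i\partial y^j$). A linear connection $\nabla$ in $\pi^{-1}(TM)$ is regular if, with $K(X)=\nabla_X\overline{\eta}$ and $H(\mathcal{T}M)=\ker K$, one has $T(\mathcal{T}M)=V(\mathcal{T}M)\oplus H(\mathcal{T}M)$; then $\beta=(\rho|_{H(\mathcal{T}M)})^{-1}$. Its torsion is $\mathbf{T}(X,Y)=\nabla_X\rho Y-\nabla_Y\rho X-\rho[X,Y]$; put $Q(\overline{X},\overline{Y})=\mathbf{T}(\beta\overline{X},\beta\overline{Y})$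 and $T(\overline{X},\overline{Y})=\mathbf{T}(\gamma\overline{X},\beta\overline{Y})$. Throughout, $\nabla$ is the Cartan connection: the unique regular connection with $\nabla g=0$, $Q=0$ and $g(T(\overline{X},\overline{Y}),\overline{Z})=g(T(\overline{X},\overline{Z}),\overline{Y})$; $T$ denotes its mixed torsion tensor $T(\overline{X},\overline{Y})=\mathbf{T}(\gamma\overline{X},\beta\overline{Y})$ and $\beta$ its horizontal map. $D$ is the Berwald connection: the unique regular connection in $\pi^{-1}(TM)$ that is torsion free, for which the canonical spray $G=\beta\circ\overline{\eta}$ is horizontal, and whose $(v)hv$-torsion $\mathbf{K}^D(\beta^D\overline{X},\gamma\overline{Y})\overline{\eta}$ vanishes ($\mathbf{K}^D$ the curvature and $\beta^D$ the horizontal map of $D$); locally, with respect to the natural fibre basis $\overline{\partial}_j$, $D_{\partial/\partial y^i}\overline{\partial}_j=0$. Definitions. $(M,L)$ is: - Riemannian if $g(x,y)$ is independent of $y$, equivalently $T=0$; - $C^v$-recurrent if there is a $\pi$-form $\lambda_o$ of order one with $(\nabla_{\gamma\overline{X}}T)(\overline{Y},\overline{Z})=\lambda_o(\overline{X})T(\overline{Y},\overline{Z})$ for all $\overline{X},\overline{Y},\overline{Z}$; - $C^0$-recurrent if there is a $\pi$-form $\lambda_o$ of order one with $(D_{\gamma\overline{X}}T)(\overline{Y},\overline{Z})=\lambda_o(\overline{X})T(\overline{Y},\overline{Z})$ for all $\overline{X},\overline{Y},\overline{Z}$.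
   Formalization: In dimension 1, ''Riemannian'' is read as T = 0 only: there T = 0 does not make g independent of y (L(y) = y for y > 0, −2y for y < 0 has T = 0 but g = 1 and 4); in all other dimensions both T = 0 and independence of g from y are concluded. *)

(* Defs.v *)
From HB Require Import structures.
From mathcomp Require Import all_boot all_order all_algebra.
From mathcomp Require Import all_classical all_reals all_analysis.
Set Implicit Arguments.
Unset Strict Implicit.
Unset Printing Implicit Defensive.
Import Order.TTheory GRing.Theory Num.Theory.
Import numFieldNormedType.Exports.
Local Open Scope classical_set_scope.
Local Open Scope ring_scope.

(* To be used on open sets U of finite-dimensional spaces, where it is the
   usual C^k (asking for differentiability and not only for continuous
   directional derivatives changes nothing there). *)
Fixpoint Ck_on (R : realType) (V W : normedModType R) (k : nat)
    (U : set V) (f : V -> W) : Prop :=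
  match k with
  | 0 => forall x, U x -> {for x, continuous f}
  | k'.+1 => (forall x, U x -> differentiable f x) /\
             (forall v : V, Ck_on k' U (fun x => 'D_v f x : W))
  end.

Definition smooth_on (R : realType) (V W : normedModType R)
    (U : set V) (f : V -> W) : Prop := forall k, Ck_on k U f.

Definition smooth_near (R : realType) (V W : normedModType R)
    (f : V -> W) (z : V) : Prop :=
  exists2 U : set V, open_nbhs z U & smooth_on U f.

(* A smooth n-manifold given by a smooth atlas.  The atlas need not be maximal.
   [prefc p] is some chart around p; choosing one for every point adds no
   geometric structure, it only makes the tangent space at p a concrete vector
   space (see [TM] below). *)
Record manifold (R : realType) (n : nat) := Manifold {
  mcarrier :> topologicalType;
  mhausdorff : hausdorff_space mcarrier;
  msecond_countable : @second_countable mcarrier;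
  chart : Type;
  cdom : chart -> set mcarrier;
  cimg : chart -> set 'rV[R]_n;
  cmap : chart -> mcarrier -> 'rV[R]_n;
  cinv : chart -> 'rV[R]_n -> mcarrier;
  cdom_open : forall i, open (cdom i);
  cimg_open : forall i, open (cimg i);
  cmap_img : forall i p, cdom i p -> cimg i (cmap i p);
  cinv_dom : forall i x, cimg i x -> cdom i (cinv i x);
  cmapK : forall i p, cdom i p -> cinv i (cmap i p) = p;
  cinvK : forall i x, cimg i x -> cmap i (cinv i x) = x;
  cmap_continuous : forall i p, cdom i p -> {for p, continuous (cmap i)};
  cinv_continuous : forall i x, cimg i x -> {for x, continuous (cinv i)};
  transition_smooth : forall i j,
    smooth_on (cimg i `&` cinv i @^-1` cdom j) (cmap j \o cinv i);
  prefc : mcarrier -> chart;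
  prefcP : forall p, cdom (prefc p) p
}.

Section Geometry.
Context {R : realType} {n : nat} (M : manifold R n).
Local Notation E := ('rV[R]_n).

Definition trans (i j : chart M) : E -> E := cmap j \o cinv i.

(* The transition map of the natural charts (x^i, y^i) of TM. *)
Definition ttrans (i j : chart M) (z : E * E) : E * E :=
  (trans i j z.1, 'd (trans i j) (z.1) z.2).

(* The tangent space at p is R^n: a tangent vector is represented by its
   components in the chart [prefc p], and its components in any other chart i
   are obtained through the differential of the transition map.  Likewise the
   fibre of pi^{-1}(TM) over u is T_{pi u}M = R^n, and T_u(TM) is R^n * R^n,
   with the components in the natural chart of TM attached to
   [prefc (pi u)].  The bundle of nonzero tangent vectors is the set [slit];
   values of the objects below outside of it are irrelevant. *)
Definition TM : Type := (M * E)%type.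
Definition slit : set TM := [set u | u.2 != 0].

Definition pchart (u : TM) : chart M := prefc u.1.
Definition coord (u : TM) : E * E := (cmap (pchart u) u.1, u.2).

(* The point of TM with coordinates z in the natural chart attached to i. *)
Definition point (i : chart M) (z : E * E) : TM :=
  let p := cinv i z.1 in (p, 'd (trans i (prefc p)) (z.1) z.2).

Definition psection := TM -> E.       (* pi-vector fields *)
Definition vfield := TM -> (E * E)%type.     (* vector fields on TM *)

(* Local expressions in the natural chart attached to i. *)
Definition repf (i : chart M) (f : TM -> R) : E * E -> R :=
  fun z => f (point i z).
Definition reps (i : chart M) (s : psection) : E * E -> E :=
  fun z => let u := point i z in
    'd (trans (pchart u) i) ((coord u).1) (s u).
Definition repv (i : chart M) (X : vfield) : E * E -> (E * E)%type :=
  fun z => let u := point i z in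
    'd (ttrans (pchart u) i) (coord u) (X u).

Definition smoothf (f : TM -> R) (u : TM) : Prop :=
  smooth_near (repf (pchart u) f) (coord u).
Definition smooths (s : psection) (u : TM) : Prop :=
  smooth_near (reps (pchart u) s) (coord u).
Definition smoothv (X : vfield) (u : TM) : Prop :=
  smooth_near (repv (pchart u) X) (coord u).

Definition vderiv (u : TM) (X : (E * E)%type) (f : TM -> R) : R :=
  'D_X (repf (pchart u) f) (coord u).

Definition bracket (X Y : vfield) : vfield := fun u =>
  'D_(X u) (repv (pchart u) Y) (coord u) -
  'D_(Y u) (repv (pchart u) X) (coord u).

Definition rho (X : vfield) : psection := fun u => (X u).1.
Definition gamma (s : psection) : vfield := fun u => (0, s u).
Definition eta : psection := fun u => u.2.
Definition vertical (X : (E * E)%type) : Prop := X.1 = 0.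

(* [nabla u X s] is the derivative at u, along X in T_u(TM), of a section s
   defined and smooth near u. *)
Definition conn := forall u : TM, (E * E)%type -> psection -> E.

(* Locality in s is a consequence of Leibniz' rule, since f is only required to
   be smooth near u. *)
Record is_connection (nabla : conn) : Prop := {
  conn_linear : forall u, slit u -> forall s, smooths s u ->
    forall (a : R) (X Y : (E * E)%type),
      nabla u (a *: X + Y) s = a *: nabla u X s + nabla u Y s;
  conn_additive : forall u, slit u -> forall s t, smooths s u -> smooths t u ->
    forall X, nabla u X (fun v => s v + t v) = nabla u X s + nabla u X t;
  conn_leibniz : forall u, slit u -> forall f s, smoothf f u -> smooths s u ->
    forall X, nabla u X (fun v => f v *: s v) =
              vderiv u X f *: s u + f u *: nabla u X s;
  conn_smooth : forall u, slit u -> forall X s, smoothv X u -> smooths s u ->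
    smooths (fun v => nabla v (X v) s) u
}.

Definition horizontal (nabla : conn) (u : TM) (X : (E * E)%type) : Prop :=
  nabla u X eta = 0.

Definition regular (nabla : conn) : Prop := forall u, slit u ->
  (forall X : (E * E)%type, exists V H : (E * E)%type,
      [/\ vertical V, horizontal nabla u H & X = V + H]) /\
  (forall X : (E * E)%type, vertical X -> horizontal nabla u X -> X = 0).

Definition beta (nabla : conn) (s : psection) : vfield := fun u =>
  xget 0 [set X : (E * E)%type | horizontal nabla u X /\ X.1 = s u].

Definition torsion (nabla : conn) (X Y : vfield) : psection := fun u =>
  nabla u (X u) (rho Y) - nabla u (Y u) (rho X) - rho (bracket X Y) u.

Definition Qtorsion (nabla : conn) (s t : psection) : psection :=
  torsion nabla (beta nabla s) (beta nabla t).
Definition mixed_torsion (nabla : conn) (s t : psection) : psection :=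
  torsion nabla (gamma s) (beta nabla t).

(* Only its vanishing is used below, so that the sign convention is
   immaterial. *)
Definition curvature (nabla : conn) (X Y : vfield) (s : psection) : psection :=
  fun u => nabla u (X u) (fun v => nabla v (Y v) s)
         - nabla u (Y u) (fun v => nabla v (X v) s)
         - nabla u (bracket X Y u) s.

(* g_u(v, w) = 1/2 v^i w^j d^2 L^2 / dy^i dy^j *)
Definition metric (L : TM -> R) (u : TM) (v w : E) : R :=
  2^-1 * 'D_v (fun y : E => 'D_w (fun y' : E => L (u.1, y') ^+ 2 : R) y : R) u.2.

Record is_finsler (L : TM -> R) : Prop := {
  finsler_homogeneous : forall (p : M) (y : E) (a : R), y != 0 -> 0 < a ->
    L (p, a *: y) = a * L (p, y);
  finsler_smooth : forall u, slit u -> smoothf L u;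
  finsler_posdef : forall u, slit u -> forall v : E, v != 0 ->
    0 < metric L u v v
}.

Record is_cartan (L : TM -> R) (nabla : conn) : Prop := {
  cartan_connection : is_connection nabla;
  cartan_regular : regular nabla;
  cartan_metric : forall u, slit u -> forall s t, smooths s u -> smooths t u ->
    forall X, vderiv u X (fun v => metric L v (s v) (t v)) =
      metric L u (nabla u X s) (t u) + metric L u (s u) (nabla u X t);
  cartan_Q : forall u, slit u -> forall s t, smooths s u -> smooths t u ->
    Qtorsion nabla s t u = 0;
  cartan_T : forall u, slit u -> forall s t r,
    smooths s u -> smooths t u -> smooths r u ->
    metric L u (mixed_torsion nabla s t u) (r u) =
    metric L u (mixed_torsion nabla s r u) (t u)
}.

(* The Berwald connection D of the Finsler manifold whose Cartan connection is
   nabla; the canonical spray is beta o eta. *)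
Record is_berwald (nabla D : conn) : Prop := {
  berwald_connection : is_connection D;
  berwald_regular : regular D;
  berwald_torsion : forall u, slit u -> forall X Y, smoothv X u -> smoothv Y u ->
    torsion D X Y u = 0;
  berwald_spray : forall u, slit u -> horizontal D u (beta nabla eta u);
  berwald_vhv : forall u, slit u -> forall s t, smooths s u -> smooths t u ->
    curvature D (beta D s) (gamma t) eta u = 0
}.

Definition is_piform1 (lambda : TM -> E -> R) : Prop :=
  (forall u, slit u -> forall (a : R) (v w : E),
      lambda u (a *: v + w) = a * lambda u v + lambda u w) /\
  (forall u, slit u -> forall s, smooths s u ->
      smoothf (fun v => lambda v (s v)) u).

(* (D_X T)(s, t) for a pi-tensor field T of type (1,2). *)
Definition cov_tensor (D : conn) (X : vfield)
    (T : psection -> psection -> psection) (s t : psection) : psection :=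
  fun u => D u (X u) (T s t)
         - T (fun v => D v (X v) s) t u
         - T s (fun v => D v (X v) t) u.

Definition recurrent (D : conn) (T : psection -> psection -> psection) : Prop :=
  exists2 lambda : TM -> E -> R, is_piform1 lambda &
    forall u, slit u -> forall r s t,
      smooths r u -> smooths s u -> smooths t u ->
      cov_tensor D (gamma r) T s t u = lambda u (r u) *: T s t u.

Definition Cv_recurrent (nabla : conn) : Prop :=
  recurrent nabla (mixed_torsion nabla).
Definition C0_recurrent (nabla D : conn) : Prop :=
  recurrent D (mixed_torsion nabla).

(* Both forms of the definition: T = 0, and g independent of y.  They agree
   when the fibres T_pM \ 0 are connected.  For n = 1 they do not, T = 0 being
   automatic while L may have different slopes on the two half-lines of T_pM;
   T = 0, i.e. g locally independent of y, is then the definition. *)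
Definition riemannian (L : TM -> R) (nabla : conn) : Prop :=
  (forall u, slit u -> forall s t, smooths s u -> smooths t u ->
      mixed_torsion nabla s t u = 0) /\
  (n != 1%N -> forall (p : M) (y y' : E), y != 0 -> y' != 0 ->
      metric L (p, y) = metric L (p, y')).

End Geometry.

(* Main.v *)
Require Import Defs.
From HB Require Import structures.
From mathcomp Require Import all_boot all_order all_algebra perm.
From mathcomp Require Import all_classical all_reals all_analysis.
Import numFieldNormedType.Exports.
Set Implicit Arguments.
Unset Strict Implicit.
Unset Printing Implicit Defensive.
Import Order.TTheory GRing.Theory Num.Theory.
Import Defs.
Local Open Scope classical_set_scope.
Local Open Scope ring_scope.

(** The special direction is the fundamental section eta.  Two facts about it
force the mixed torsion T to vanish as soon as T is recurrent in the vertical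
directions.

First, T(X, eta) = 0 for the Cartan connection.  Fix u = (p, y) and put
F = L(p, .)^2.  By homogeneity g(y, c) = g(c, y) = (1/2) D_c F(y), so that
differentiating g(eta, c) in the vertical direction a gives back g(a, c).
Metricity applied to eta and to a section with constant components c, together
with nabla_a eta = T(a, eta) + a, yields g(T(a, eta), c) + g(y, T(a, c)) = 0,
and the symmetry axiom of T turns the second term into the first one.  Hence
g(T(a, eta), c) = 0 for all c ([cartan_vert_eta], [mixed_torsion_eta]).

Second, D_{gamma X} eta = X, both for the Cartan connection (this is the first
fact again) and for the Berwald connection, where it is the vanishing of the
torsion on gamma X and a field that projects onto eta ([berwald_vert_eta]).

Differentiating T(Y, eta) = 0 along gamma X therefore gives
(D_{gamma X} T)(Y, eta) = - T(Y, X), whereas recurrence makes the left side a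
multiple of T(Y, eta) = 0.  So T = 0 ([recurrent_mixed_torsion0]).

Finally, when T = 0, metricity says that the components of g have zero
derivative along the fibres.  In dimension at least two any two nonzero vectors
of T_pM are joined by a broken line that avoids 0 and passes through vectors of
the standard basis, and g is constant along it
([riemannian_of_mixed_torsion0]).

All computations rest on the formula
T(s, t)(u) = nabla_{(0, s u)} t - D_{(0, s u)} t, with t read in the natural
chart at u on the right ([mixed_torsionE]).  The bracket in the definition of T
differentiates the horizontal lift of t, so the formula requires that lift to be
differentiable: it is obtained by inverting the matrix of the vertical part of
X |-> nabla_X eta ([beta_differentiable]). *)

(** * Differential calculus *)

(** Keeping the differential locked, and free of the filter of neighbourhoods that
it is taken along, prevents unification from comparing differentials of distinct
maps by unfolding them. *)
HB.lock Definition dif (R : realType) (V W : normedModType R) (f : V -> W)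
  (x v : V) : W := 'd f x v.

Section Calculus.
Context {R : realType}.
Implicit Types (U V W : normedModType R).

(** The difference of the two functions is zero near x, hence a little o of
anything. *)
Lemma near_eq_differentiable V W (f g : V -> W) (x : V) :
  (\forall z \near x, f z = g z) -> differentiable f x -> differentiable g x.
Proof.
move=> fg df; pose h := g - f.
have h0 : \forall z \near x, h z = 0.
  by apply: filterS fg => z fgz; rewrite -[h z]/(g z - f z) fgz subrr.
have c0 : continuous (\0 : {linear V -> W}) by move=> z; exact: cvg_cst.
have ho : h \o shift x = cst (h x) + (\0 : {linear V -> W}) +o_ (0:V) id.
  apply/eqaddoP => _/posnumP[e]; rewrite (nbhs_singleton h0).
  have := h0; rewrite (near_shift 0) subr0 => h0'.
  near=> z; rewrite !fctE /=.
  have -> : h (z + x) = 0 by near: z; exact: h0'.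
  by rewrite !(subr0, addr0, normr0) mulr_ge0.
have -> : g = f + h by rewrite /h addrC subrK.
apply: differentiableD => //.
by apply/diff_locallyP; rewrite (diff_unique c0 ho).
Unshelve. all: by end_near. Qed.

Lemma difE V W (f : V -> W) (x v : V) : dif f x v = 'd f x v.
Proof. by rewrite dif.unlock. Qed.

Lemma dif_is_linear V W (f : V -> W) x : linear (dif f x).
Proof. by move=> a u v; rewrite !difE linearP. Qed.

HB.instance Definition _ V W (f : V -> W) x :=
  GRing.isLinear.Build R V W _ (dif f x) (@dif_is_linear V W f x).

Lemma deriveE_dif V W (f : V -> W) x v : differentiable f x -> 'D_v f x = dif f x v.
Proof. by move=> df; rewrite difE deriveE. Qed.

Lemma near_eq_dif V W (f g : V -> W) (x v : V) :
  (\forall z \near x, f z = g z) -> differentiable f x -> dif g x v = dif f x v.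
Proof.
move=> fg df; rewrite -!deriveE_dif //; last exact: near_eq_differentiable df.
by apply: near_eq_derive; apply: filterS fg.
Qed.

Lemma dif_comp U V W (f : U -> V) (g : V -> W) x v :
  differentiable f x -> differentiable g (f x) ->
  dif g (f x) (dif f x v) = dif (g \o f) x v.
Proof. by move=> df dg; rewrite !difE (congr1 (@^~ v) (diff_comp df dg)). Qed.

Lemma continuous_dif V W (f : V -> W) x : differentiable f x -> continuous (dif f x).
Proof.
move=> df; rewrite (_ : dif f x = 'd f x); first exact: diff_continuous.
by apply/funext => v; rewrite difE.
Qed.

Lemma dif_linear V W (l : {linear V -> W}) x v : continuous l -> dif l x v = l v.
Proof. by move=> cl; rewrite !difE diff_lin. Qed.

Lemma dif_id V (x v : V) : dif id x v = v.
Proof. by rewrite -(@deriveE_dif V V id) // derive_id. Qed.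

Lemma dif_pair U V W (f : U -> V) (g : U -> W) x v :
  differentiable f x -> differentiable g x ->
  dif (fun z => (f z, g z)) x v = (dif f x v, dif g x v).
Proof. by move=> df dg; rewrite !difE (congr1 (@^~ v) (diff_pair df dg)). Qed.

Lemma differentiable_coordE V m n (f : V -> 'M[R]_(m, n)) x i j :
  differentiable f x -> differentiable (fun z => f z i j : R) x.
Proof.
move=> df; apply: (@differentiable_comp _ _ _ _ f (fun N : 'M[R]_(m, n) => N i j)) => //.
exact: differentiable_coord.
Qed.

Lemma differentiable_bigsum V W I (r : seq I) (P : pred I) (f : I -> V -> W) x :
  (forall i, P i -> differentiable (f i) x) ->
  differentiable (fun z => \sum_(i <- r | P i) f i z) x.
Proof.
move=> df; have -> : (fun z => \sum_(i <- r | P i) f i z) = \sum_(i <- r | P i) f i.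
  by apply/funext => z; rewrite (big_morph (fun h : V -> W => h z) (id1 := 0) (op1 := +%R)).
by elim/big_ind : _ => // ? ? g h; apply: differentiableD; [exact:g|exact:h].
Qed.

Lemma differentiable_bigprod V I (r : seq I) (P : pred I) (f : I -> V -> R) x :
  (forall i, P i -> differentiable (f i) x) ->
  differentiable (fun z => \prod_(i <- r | P i) f i z) x.
Proof.
move=> df; have -> : (fun z => \prod_(i <- r | P i) f i z) = \prod_(i <- r | P i) f i.
  by apply/funext => z; rewrite (big_morph (fun h : V -> R => h z) (id1 := 1) (op1 := *%R)).
by elim/big_ind : _ => // ? ? g h; apply: differentiableM; [exact:g|exact:h].
Qed.

Lemma differentiable_mx V m n (f : V -> 'M[R]_(m, n)) x :
  (forall i j, differentiable (fun z => f z i j : R) x) -> differentiable f x.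
Proof.
move=> df.
have -> : f = fun z => \sum_i \sum_j f z i j *: delta_mx i j.
  by apply/funext => z; exact: matrix_sum_delta.
apply: differentiable_bigsum => i _; apply: differentiable_bigsum => j _.
exact: differentiableZl.
Qed.

Lemma differentiable_scale V n (k : V -> R) (f : V -> 'rV[R]_n) x :
  differentiable k x -> differentiable f x ->
  differentiable (fun z => k z *: f z) x.
Proof.
move=> dk df; apply: differentiable_mx => i j.
rewrite (_ : (fun z => _) = k * (fun z => f z i j)); last first.
  by apply/funext => z; rewrite mxE.
by apply: differentiableM => //; exact: differentiable_coordE.
Qed.

Lemma differentiable_mulmx V m n p (A : V -> 'M[R]_(m, n)) (B : V -> 'M[R]_(n, p)) x :
  differentiable A x -> differentiable B x ->
  differentiable (fun z => A z *m B z) x.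
Proof.
move=> dA dB; apply: differentiable_mx => i j.
under eq_fun do rewrite mxE.
apply: differentiable_bigsum => k _.
by apply: differentiableM; exact: differentiable_coordE.
Qed.

(** The determinant is a polynomial in the entries. *)
Lemma differentiable_det V n (A : V -> 'M[R]_n) x :
  differentiable A x -> differentiable (fun z => \det (A z) : R) x.
Proof.
move=> dA; rewrite /determinant; apply: differentiable_bigsum => s _.
rewrite (_ : (fun z => _) = (cst ((-1) ^+ s)) * (fun z => \prod_i A z i (s i))) //.
apply: differentiableM => //.
by apply: differentiable_bigprod => i _; exact: differentiable_coordE.
Qed.

(** Cramer's rule: the inverse is the adjugate over the determinant.  The matrix
has to be invertible near x, since [invmx] is the identity elsewhere. *)
Lemma differentiable_invmx V n (A : V -> 'M[R]_n) x :
  (\forall z \near x, A z \in unitmx) -> differentiable A x ->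
  differentiable (fun z => invmx (A z)) x.
Proof.
move=> Au dA; apply: (@near_eq_differentiable _ _
  (fun z => (\det (A z))^-1 *: \adj (A z))).
  by apply: filterS Au => z Az; rewrite /invmx Az.
apply: differentiable_mx => i j.
rewrite (_ : (fun z => _) = (fun z => (\det (A z))^-1) * (fun z => \adj (A z) i j));
  last by apply/funext => z; rewrite mxE.
apply: differentiableM.
  have dd := differentiable_det dA.
  have := nbhs_singleton Au; rewrite unitmxE unitfE => d0.
  exact: (differentiableV dd d0).
under eq_fun do rewrite mxE /cofactor.
rewrite (_ : (fun z => _) = cst ((-1) ^+ (j + i)) *
  (fun z => \det (row' j (col' i (A z))))) //.
apply: differentiableM => //; apply: differentiable_det.
apply: differentiable_mx => k l; under eq_fun do rewrite !mxE.
exact: differentiable_coordE.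
Qed.

Lemma derive_pair_fst U V W (f : U -> V * W) x v : differentiable f x ->
  ('D_v f x).1 = 'D_v (fun z => (f z).1) x.
Proof.
move=> dx; have df := @diff_derivable _ _ _ f x v dx; apply/esym; rewrite {1}/derive; apply: cvg_lim => //.
have c : fst p @[p --> 'D_v f x] --> ('D_v f x).1 by exact: cvg_fst.
exact: (@cvg_comp _ _ _ _ fst _ _ _ df c).
Qed.

Lemma derive_affine U V W (f : V -> W) (a : V) (l : {linear U -> V}) y v :
  'D_v (fun z => f (a + l z)) y = 'D_(l v) f (a + l y).
Proof.
rewrite /derive; set d := (fun _ : R => _); set d' := (fun _ : R => _).
suff -> : d = d' by [].
by apply/funext => h; rewrite /d /d' /= (linearD l) (linearZZ l) addrCA.
Qed.

Lemma differentiable_linear_comp V W W' (l : {linear W -> W'}) (f : V -> W) x :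
  continuous l -> differentiable f x -> differentiable (fun z => l (f z)) x.
Proof.
move=> cl df; apply: (@differentiable_comp _ _ _ _ f l) => //.
exact: linear_differentiable.
Qed.

Lemma derive_linear_comp V W W' (l : {linear W -> W'}) (f : V -> W) x v :
  continuous l -> differentiable f x -> 'D_v (fun z => l (f z)) x = l ('D_v f x).
Proof.
move=> cl df; rewrite !deriveE //; last exact: differentiable_linear_comp.
rewrite (@diff_comp _ _ _ _ f l) //; last exact: linear_differentiable.
by rewrite /= diff_lin.
Qed.

Lemma Ck_onW V W k (A : set V) (f : V -> W) : Ck_on k.+1 A f -> Ck_on k A f.
Proof.
elim: k f => [|k IH] f [df Df]; first by move=> x /df /differentiable_continuous.
by split=> // v; apply/IH/Df.
Qed.

Lemma Ck_on_sub V W k (A B : set V) (f : V -> W) :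
  A `<=` B -> Ck_on k B f -> Ck_on k A f.
Proof.
move=> AB; elim: k f => [|k IH] f /=; first by move=> cf x /AB /cf.
by move=> [df Df]; split=> [x /AB /df //|v]; exact/IH/Df.
Qed.

Lemma Ck_on_ext V W k (A : set V) (f g : V -> W) : open A ->
  (forall x, A x -> f x = g x) -> Ck_on k A f -> Ck_on k A g.
Proof.
move=> oA; have nA x : A x -> \forall z \near x, A z by move=> Ax; exact: open_nbhs_nbhs.
elim: k f g => [|k IH] f g fg /=.
  move=> cf x Ax; have := cf x Ax; rewrite /prop_for /continuous_at -(fg x Ax).
  by apply: cvg_trans; apply: near_eq_cvg; apply: filterS (nA x Ax) => z /fg.
move=> [df Df]; split=> [x Ax|v].
  by apply: near_eq_differentiable (df x Ax); apply: filterS (nA x Ax) => z /fg.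
apply: IH (Df v) => x Ax.
by apply: near_eq_derive; apply: filterS (nA x Ax) => z /fg.
Qed.

Lemma Ck_on_cst V W k (A : set V) (a : W) : Ck_on k A (fun _ : V => a).
Proof.
elim: k a => [|k IH] a /=; first by move=> x _; exact: cvg_cst.
split=> [x _|v]; first exact: differentiable_cst.
by under eq_fun do rewrite derive_cst; exact: IH.
Qed.

Lemma Ck_on_linear V W k (A : set V) (l : {linear V -> W}) :
  continuous l -> Ck_on k A l.
Proof.
move=> cl; case: k => [|k] /=; first by move=> x _; exact: cl.
have dl x : differentiable l x by exact: linear_differentiable.
split=> // v.
by under eq_fun do rewrite deriveE // diff_lin //; exact: Ck_on_cst.
Qed.

Lemma Ck_on_linear_comp V W W' k (A : set V) (l : {linear W -> W'}) (f : V -> W) :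
  open A -> continuous l -> Ck_on k A f -> Ck_on k A (fun z => l (f z)).
Proof.
move=> oA cl; elim: k f => [|k IH] f /=.
  move=> cf x Ax; exact: (continuous_comp (cf x Ax) (cl _)).
move=> [df Df]; split=> [x /df|v]; first exact: differentiable_linear_comp.
apply: Ck_on_ext (IH _ (Df v)) => // x Ax.
by rewrite derive_linear_comp //; exact: df.
Qed.

Lemma Ck_on_affine U V W k (A : set U) (B : set V) (f : V -> W) (a : V)
    (l : {linear U -> V}) : continuous l -> (forall z, A z -> B (a + l z)) ->
  Ck_on k B f -> Ck_on k A (fun z => f (a + l z)).
Proof.
move=> cl AB.
have da z : differentiable (fun z => a + l z) z.
  rewrite (_ : (fun z => _) = cst a + l) //.
  by apply: differentiableD => //; exact: linear_differentiable.
elim: k f => [|k IH] f /=.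
  move=> cf x Ax; exact: (continuous_comp (differentiable_continuous (da x)) (cf _ (AB x Ax))).
move=> [df Df]; split=> [x Ax|v]; last first.
  under eq_fun do rewrite derive_affine.
  exact: (IH (fun z => 'D_(l v) f z) (Df (l v))).
by apply: (@differentiable_comp _ _ _ _ (fun z => a + l z) f) => //; exact/df/AB.
Qed.

Lemma Ck_on_add V W k (A : set V) (f g : V -> W) : open A ->
  Ck_on k A f -> Ck_on k A g -> Ck_on k A (fun z => f z + g z).
Proof.
move=> oA; elim: k f g => [|k IH] f g /=.
  by move=> cf cg x Ax; apply: continuousD; [exact: cf|exact: cg].
move=> [df Df] [dg Dg]; split=> [x Ax|v].
  by apply: differentiableD; [exact: df|exact: dg].
apply: Ck_on_ext (IH _ _ (Df v) (Dg v)) => // x Ax.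
by rewrite -deriveD //; apply: diff_derivable; [exact: df|exact: dg].
Qed.

Lemma Ck_on_mul V k (A : set V) (f g : V -> R) : open A ->
  Ck_on k A f -> Ck_on k A g -> Ck_on k A (fun z => f z * g z).
Proof.
move=> oA; elim: k f g => [|k IH] f g.
  by move=> cf cg x Ax; apply: continuousM; [exact: cf|exact: cg].
move=> cf cg; have [df Df] := cf; have [dg Dg] := cg.
split=> [x Ax|v]; first by apply: differentiableM; [exact: df|exact: dg].
apply: Ck_on_ext (Ck_on_add oA (IH _ _ (Ck_onW cf) (Dg v))
  (IH _ _ (Ck_onW cg) (Df v))) => // x Ax.
rewrite -[RHS]/('D_v (f * g) x) deriveM //.
  by apply: diff_derivable; exact: df.
by apply: diff_derivable; exact: dg.
Qed.

Lemma smooth_near_ext V W (f g : V -> W) z :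
  (\forall x \near z, f x = g x) -> smooth_near f z -> smooth_near g z.
Proof.
rewrite /prop_near1 nbhsE => -[B [oB Bz] fg] [A [oA Az] sf].
exists (A `&` B); first by split=> //; exact: openI.
move=> k; apply: (@Ck_on_ext _ _ _ _ f) => [|x [_ /fg]//|]; first exact: openI.
by apply: Ck_on_sub (sf k) => x [].
Qed.

Lemma smooth_near_differentiable V W (f : V -> W) z :
  smooth_near f z -> \forall x \near z, differentiable f x.
Proof.
move=> [A oA sf]; apply: filterS (open_nbhs_nbhs oA) => x Ax.
by have [+ _] := sf 1%N; apply.
Qed.

Lemma smooth_near_linear V W (l : {linear V -> W}) z :
  continuous l -> smooth_near l z.
Proof.
move=> cl; exists setT; first by split=> //; exact: openT.
by move=> k; exact: Ck_on_linear.
Qed.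

Lemma smooth_near_cst V W (a : W) (z : V) : smooth_near (fun=> a) z.
Proof.
exists setT; first by split=> //; exact: openT.
by move=> k; exact: Ck_on_cst.
Qed.

Lemma smooth_near_linear_comp V W W' (l : {linear W -> W'}) (f : V -> W) z :
  continuous l -> smooth_near f z -> smooth_near (fun x => l (f x)) z.
Proof.
move=> cl [A [oA Az] sf]; exists A => // k; exact: Ck_on_linear_comp (sf k).
Qed.

Lemma linear_inr (V W : normedModType R) : linear (fun w : W => (0 : V, w)).
Proof. by move=> a u v; congr pair; rewrite /= ?scaler0 ?addr0. Qed.
Lemma linear_spray (V : normedModType R) :
  linear (fun z : (V * V)%type => (z.2, 0 : V)).
Proof. by move=> a u v; congr pair; rewrite /= ?scaler0 ?addr0. Qed.

Definition lfst (V W : normedModType R) : {linear (V * W)%type -> V} := fst.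
Definition lsnd (V W : normedModType R) : {linear (V * W)%type -> W} := snd.
Definition linr (V W : normedModType R) : {linear W -> (V * W)%type} :=
  HB.pack (fun w : W => (0 : V, w))
    (GRing.isLinear.Build _ _ _ _ _ (@linear_inr V W)).
(** The local expression of the spray with zero coefficients. *)
Definition lspray (V : normedModType R) : {linear (V * V)%type -> (V * V)%type} :=
  HB.pack (fun z : (V * V)%type => (z.2, 0 : V))
    (GRing.isLinear.Build _ _ _ _ _ (@linear_spray V)).

Lemma continuous_lfst V W : continuous (lfst V W).
Proof. by move=> x; exact: cvg_fst. Qed.
Lemma continuous_lsnd V W : continuous (lsnd V W).
Proof. by move=> x; exact: cvg_snd. Qed.
Lemma continuous_linr V W : continuous (linr V W).
Proof. by move=> x; apply: cvg_pair; [exact: cvg_cst|exact: cvg_id]. Qed.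
Lemma continuous_lspray V : continuous (lspray V).
Proof. by move=> x; apply: cvg_pair; [exact: cvg_snd|exact: cvg_cst]. Qed.

Lemma differentiable_fst (V W : normedModType R) (x : V * W) : differentiable fst x.
Proof. exact: (linear_differentiable x (@continuous_lfst V W)). Qed.

Lemma differentiable_snd (V W : normedModType R) (x : V * W) : differentiable snd x.
Proof. exact: (linear_differentiable x (@continuous_lsnd V W)). Qed.

Lemma near_fst (V W : normedModType R) (x : V * W) (P : set V) :
  (\forall y \near x.1, P y) -> \forall z \near x, P z.1.
Proof. by move=> Px; apply: (@cvg_fst _ _ (nbhs x.1) (nbhs x.2)). Qed.

Lemma near_snd (V W : normedModType R) (x : V * W) (P : set W) :
  (\forall y \near x.2, P y) -> \forall z \near x, P z.2.
Proof. by move=> Px; apply: (@cvg_snd _ _ (nbhs x.1) (nbhs x.2)). Qed.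

Lemma near_neq0 (V : normedModType R) (x : V) : x != 0 -> \forall z \near x, z != 0.
Proof.
by move=> x0; apply: (@cvgr_neq0 _ _ _ _ _ id x) => //; exact: cvg_id.
Qed.

(** For an arbitrary f: the two difference quotients are the same function of the
increment. *)
Lemma derive_vert (U V W : normedModType R) (f : U * V -> W) z b :
  'D_((0, b) : U * V) f z = 'D_b (fun y => f (z.1, y)) z.2.
Proof.
rewrite /derive; set d := (fun _ : R => _); set d' := (fun _ : R => _).
suff -> : d = d' by [].
apply/funext => h; rewrite {}/d {}/d' /=; case: z => x y /=.
suff -> : h *: ((0, b) : U * V) + (x, y) = (x, h *: b + y) by [].
have e : h *: (0 : U) + x = x by rewrite scaler0 add0r.
by rewrite -[in RHS]e.
Qed.

Lemma derive_along_line (V W : normedModType R) (f : V -> W) (x w : V) (a : R) :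
  'D_1 (fun h : R => f (x + h *: w)) a = 'D_w f (x + a *: w).
Proof.
apply: (congr1 (fun q : R -> W => lim (q @ 0^'))).
by apply/funext => h; rewrite /= [h *: 1]mulr1 scalerDl addrCA.
Qed.

Lemma derive_line (V W : normedModType R) (f : V -> W) (x w : V) :
  'D_w f x = 'D_1 (fun h : R => f (x + h *: w)) 0.
Proof. by rewrite derive_along_line scale0r addr0. Qed.

Lemma derive_scale_dir (V W : normedModType R) (f : V -> W) x (w : V) a :
  differentiable f x -> 'D_(a *: w) f x = a *: 'D_w f x.
Proof. by move=> df; rewrite !deriveE_dif // linearZ. Qed.

(** Dilations with a factor close to 1 are positive, which is all that Euler's
relations see of homogeneity. *)
Lemma near0_gt0 : \forall h \near (0 : R), 0 < 1 + h.
Proof.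
near=> h; rewrite -ltrBlDl sub0r; near: h.
by apply: lt_nbhsr; rewrite oppr_lt0.
Unshelve. all: by end_near. Qed.

(** Euler's relation: the difference quotient only sees the ray through y, where f
is determined by homogeneity. *)
Lemma euler1 V (f : V -> R) (y : V) :
  (forall a : R, 0 < a -> f (a *: y) = a * f y) -> 'D_y f y = f y.
Proof.
move=> hf; rewrite derive_line.
rewrite (near_eq_derive (g := fun h : R => (1 + h) * f y)); last first.
  by apply: filterS near0_gt0 => h h0; rewrite -hf // scalerDl scale1r.
by rewrite derive_val /= scaler0 add0r /GRing.scale /= add0r mulr1.
Qed.

Lemma euler2 V (f : V -> R) (y : V) :
  (forall a : R, 0 < a -> f (a *: y) = a ^+ 2 * f y) -> 'D_y f y = 2 * f y.
Proof.
move=> hf; rewrite derive_line.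
rewrite (near_eq_derive (g := fun h : R => (1 + h) ^+ 2 * f y)); last first.
  by apply: filterS near0_gt0 => h h0; rewrite -hf // scalerDl scale1r.
rewrite derive_val /= /GRing.scale /= !(addr0, add0r, mulr1, mul1r, mulr0) mulrC.
by [].
Qed.

End Calculus.

(** * Changes of charts *)

Section Charts.
Context {R : realType} {n : nat} (M : manifold R n).
Local Notation E := ('rV[R]_n).
Implicit Types (i j k : chart M).

(** The part of the image of chart i on which [trans i j] is a change of charts;
elsewhere [trans i j] has no meaning. *)
Definition overlap i j : set E := cimg i `&` cinv i @^-1` cdom j.

Lemma overlap_near i j x : overlap i j x -> \forall z \near x, overlap i j z.
Proof.
move=> [ix jx].
have ci : \forall z \near x, cimg i z.
  by apply: open_nbhs_nbhs; split=> //; exact: cimg_open.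
apply: filterI => //.
by apply: (cinv_continuous ix); apply: open_nbhs_nbhs; split=> //; exact: cdom_open.
Qed.

Lemma overlap_refl i x : cimg i x -> overlap i i x.
Proof. by move=> ix; split=> //; exact: cinv_dom. Qed.

Lemma differentiable_trans i j x : overlap i j x -> differentiable (trans i j) x.
Proof. by move=> ox; have [+ _] := @transition_smooth _ _ M i j 1%N; apply. Qed.

Lemma differentiable_derive_trans i j x v : overlap i j x -> differentiable (fun y => 'D_v (trans i j) y) x.
Proof.
by move=> ox; have [_ /(_ v)[+ _]] := @transition_smooth _ _ M i j 2%N; apply.
Qed.

Lemma cinv_trans i j x : overlap i j x -> cinv j (trans i j x) = cinv i x.
Proof. by move=> [ix jx]; rewrite /trans /= cmapK. Qed.

Lemma overlap_trans i j k x : overlap i j x -> overlap i k x -> overlap j k (trans i j x).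
Proof.
move=> oj [_ kx]; split; first by case: oj => _; exact: cmap_img.
by rewrite /preimage /= cinv_trans.
Qed.

Lemma trans_comp i j k x : overlap i j x -> trans j k (trans i j x) = trans i k x.
Proof. by move=> oj; rewrite /trans /= -/(trans i j x) cinv_trans. Qed.

Lemma trans_id i x : cimg i x -> trans i i x = x.
Proof. by move=> ix; rewrite /trans /= cinvK. Qed.

Lemma dtrans_comp i j k x v : overlap i j x -> overlap i k x ->
  dif (trans j k) (trans i j x) (dif (trans i j) x v) = dif (trans i k) x v.
Proof.
move=> oj ok.
have dj := differentiable_trans oj; have djk := differentiable_trans (overlap_trans oj ok).
rewrite [LHS](dif_comp v dj djk); apply: near_eq_dif (differentiable_trans ok).
by apply: filterS (overlap_near oj) => z oz /=; rewrite trans_comp.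
Qed.

Lemma dtrans_id i x v : cimg i x -> dif (trans i i) x v = v.
Proof.
move=> ix; rewrite (@near_eq_dif _ _ _ id) ?dif_id //.
by apply: filterS (overlap_near (overlap_refl ix)) => z [iz _]; rewrite trans_id.
Qed.

Lemma overlap_near_fibre i j (z : E * E) : overlap i j z.1 -> \forall w \near z, overlap i j w.1.
Proof. by move=> oz; exact: near_fst (overlap_near oz). Qed.

Lemma ttransE i j z : ttrans i j z = (trans i j z.1, dif (trans i j) z.1 z.2).
Proof. by rewrite difE. Qed.

(** Expanding the fibre coordinate on the standard basis reduces joint
differentiability to that of the partial derivatives of the transition map. *)
Lemma differentiable_dtrans i j (z : E * E) : overlap i j z.1 ->
  differentiable (fun w : E * E => dif (trans i j) w.1 w.2) z.
Proof.
move=> oz; apply: (@near_eq_differentiable _ _ _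
  (fun w : E * E => \sum_k w.2 0 k *: 'D_(delta_mx 0 k) (trans i j) w.1)).
  apply: filterS (overlap_near_fibre oz) => w ow.
  rewrite [in RHS](row_sum_delta w.2) linear_sum; apply: eq_bigr => k _.
  by rewrite linearZ deriveE_dif //; exact: differentiable_trans.
apply: differentiable_bigsum => k _; apply: differentiable_scale.
  by apply: differentiable_coordE; exact: differentiable_snd.
apply: (@differentiable_comp _ _ _ _ fst (fun y => 'D_(delta_mx 0 k) (trans i j) y)).
  exact: differentiable_fst.
exact: differentiable_derive_trans.
Qed.

Lemma differentiable_trans_fst i j (z : E * E) : overlap i j z.1 ->
  differentiable (fun w : E * E => trans i j w.1) z.
Proof.
move=> oz; apply: (@differentiable_comp _ _ _ _ fst (trans i j)).
  exact: differentiable_fst.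
exact: differentiable_trans.
Qed.

Lemma ttrans_pair i j :
  ttrans i j = fun z => (trans i j z.1, dif (trans i j) z.1 z.2).
Proof. by apply/funext => z; rewrite ttransE. Qed.

Lemma differentiable_ttrans i j z : overlap i j z.1 -> differentiable (ttrans i j) z.
Proof.
move=> oz; rewrite ttrans_pair; apply: differentiable_pair; first exact: differentiable_trans_fst.
exact: differentiable_dtrans.
Qed.

Lemma dttransE i j z w : overlap i j z.1 -> dif (ttrans i j) z w =
  (dif (trans i j) z.1 w.1, dif (fun w : E * E => dif (trans i j) w.1 w.2) z w).
Proof.
move=> oz.
have d1 := differentiable_trans_fst oz; have d2 := differentiable_dtrans oz.
rewrite ttrans_pair (dif_pair w d1 d2); congr pair.
rewrite -[LHS](dif_comp w (differentiable_fst z) (differentiable_trans oz)).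
by rewrite [X in dif _ _ X](dif_linear z w (@continuous_lfst _ E E)).
Qed.

Lemma dttrans1 i j z w : overlap i j z.1 ->
  (dif (ttrans i j) z w).1 = dif (trans i j) z.1 w.1.
Proof. by move=> oz; rewrite dttransE. Qed.

(** On a fibre [ttrans] is linear, hence its own derivative. *)
Lemma dttrans_vert i j z b : overlap i j z.1 ->
  dif (ttrans i j) z (0, b) = (0, dif (trans i j) z.1 b).
Proof.
move=> oz; rewrite dttransE // linear0; congr pair.
have c := continuous_dif (differentiable_trans oz).
rewrite -deriveE_dif; last exact: differentiable_dtrans.
rewrite derive_vert deriveE_dif; first exact: (dif_linear z.2 b c).
exact: (linear_differentiable z.2 c).
Qed.

Lemma ttrans_comp i j k z : overlap i j z.1 -> overlap i k z.1 ->
  ttrans j k (ttrans i j z) = ttrans i k z.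
Proof. by move=> oj ok; rewrite !ttransE /= trans_comp // dtrans_comp. Qed.

Lemma ttrans_id i z : cimg i z.1 -> ttrans i i z = z.
Proof. by move=> oz; rewrite ttransE trans_id // dtrans_id //; case: z oz. Qed.

Lemma dttrans_comp i j k z v : overlap i j z.1 -> overlap i k z.1 ->
  dif (ttrans j k) (ttrans i j z) (dif (ttrans i j) z v) = dif (ttrans i k) z v.
Proof.
move=> oj ok.
have dj := differentiable_ttrans oj.
have djk : differentiable (ttrans j k) (ttrans i j z).
  by apply: differentiable_ttrans; exact: overlap_trans.
rewrite [LHS](dif_comp v dj djk).
apply: (near_eq_dif v _ (differentiable_ttrans ok)).
near=> w; rewrite /= ttrans_comp //.
  by near: w; exact: overlap_near_fibre.
by near: w; exact: overlap_near_fibre.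
Unshelve. all: by end_near. Qed.

Lemma dttrans_id i z v : cimg i z.1 -> dif (ttrans i i) z v = v.
Proof.
move=> iz; rewrite (@near_eq_dif _ _ _ id) ?dif_id //.
by apply: filterS (overlap_near_fibre (overlap_refl iz)) => w [iw _]; rewrite ttrans_id.
Qed.

Lemma dtransK i k x v : overlap i k x ->
  dif (trans i k) x (dif (trans k i) (trans i k x) v) = v.
Proof.
move=> ok; have ix : cimg i x by case: ok.
have oki := overlap_trans ok (overlap_refl ix); have okk := overlap_trans ok ok.
have e : trans k i (trans i k x) = x by rewrite (trans_comp i ok) trans_id.
have e1 := congr1 (fun y => dif (trans i k) y (dif (trans k i) (trans i k x) v)) e.
have e2 := dtrans_comp v oki okk.
have e3 := dtrans_id v okk.1.
exact: etrans (esym e1) (etrans e2 e3).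
Qed.

Lemma dttransK i k z v : overlap i k z.1 ->
  dif (ttrans i k) z (dif (ttrans k i) (ttrans i k z) v) = v.
Proof.
move=> ok; have iz : cimg i z.1 by case: ok.
have oki : overlap k i (ttrans i k z).1 := overlap_trans ok (overlap_refl iz).
have okk : overlap k k (ttrans i k z).1 := overlap_trans ok ok.
have e : ttrans k i (ttrans i k z) = z.
  by rewrite (ttrans_comp ok (overlap_refl iz)) ttrans_id.
have e1 := congr1 (fun y => dif (ttrans i k) y (dif (ttrans k i) (ttrans i k z) v)) e.
have e2 := dttrans_comp v oki okk.
have e3 := dttrans_id v okk.1.
exact: etrans (esym e1) (etrans e2 e3).
Qed.

End Charts.

(** * Sections and vector fields in natural charts *)

Section Sections.
Context {R : realType} {n : nat} (M : manifold R n).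
Local Notation E := ('rV[R]_n).
Local Notation TM := (TM M).
Implicit Types (i j k : chart M) (u v : TM) (z : E * E) (s t r : psection M) (X Y : vfield M).

Lemma overlap_point i z : cimg i z.1 -> overlap i (pchart (point i z)) z.1.
Proof. by move=> iz; split=> //; exact: prefcP. Qed.

Lemma coord_point i z : cimg i z.1 ->
  coord (point i z) = ttrans i (pchart (point i z)) z.
Proof. by []. Qed.

Lemma cimg_coord u : cimg (pchart u) (coord u).1.
Proof. by apply: cmap_img; exact: prefcP. Qed.

Lemma point_eq i z : point i z =
  (cinv i z.1, dif (trans i (pchart (point i z))) z.1 z.2).
Proof. by rewrite difE. Qed.

Lemma point_ttrans i j z : overlap j i z.1 -> point i (ttrans j i z) = point j z.
Proof.
move=> oji; have ok := overlap_point oji.1.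
have ep : cinv i (trans j i z.1) = cinv j z.1 by exact: cinv_trans.
have pk : pchart (point i (ttrans j i z)) = pchart (point j z) := congr1 (@prefc _ _ M) ep.
have e2 : (ttrans j i z).2 = dif (trans j i) z.1 z.2 by rewrite ttransE.
rewrite point_eq pk [RHS]point_eq e2; congr pair; first exact: ep.
exact: (dtrans_comp z.2 oji ok).
Qed.

Lemma point_pchart u y : point (pchart u) ((coord u).1, y) = (u.1, y).
Proof.
have pu : cinv (pchart u) (coord u).1 = u.1 by apply: cmapK; exact: prefcP.
have pk : pchart (point (pchart u) ((coord u).1, y)) = pchart u.
  by rewrite {1}/pchart -[LHS]/(prefc (cinv (pchart u) (coord u).1)) pu.
rewrite point_eq pk; congr pair; first exact: pu.
by rewrite dtrans_id //; exact: cimg_coord.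
Qed.

Lemma point_coord u : point (pchart u) (coord u) = u.
Proof. by rewrite [X in point _ X]surjective_pairing point_pchart; case: u. Qed.

Lemma slit_point i z : cimg i z.1 -> slit (point i z) <-> z.2 != 0.
Proof.
move=> iz; have ok := overlap_point iz.
have e2 : (point i z).2 = dif (trans i (pchart (point i z))) z.1 z.2.
  by rewrite {1}point_eq.
rewrite -[slit _]/(is_true ((point i z).2 != 0)) e2; set k := pchart _ in ok *.
split; first by apply: contra_neq => ->; rewrite linear0.
apply: contra_neq => e.
by rewrite -(dtrans_id z.2 iz) -(dtrans_comp z.2 ok (overlap_refl iz)) e linear0.
Qed.

Lemma repsE i s z : reps i s z =
  dif (trans (pchart (point i z)) i) (coord (point i z)).1 (s (point i z)).
Proof. by rewrite difE. Qed.

Lemma repvE i X z : repv i X z =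
  dif (ttrans (pchart (point i z)) i) (coord (point i z)) (X (point i z)).
Proof. by rewrite difE. Qed.

(** How local expressions are computed below: it suffices to recognise the value
of the section as the image of a vector of chart i under the change of charts. *)
Lemma reps_eq i s z a : cimg i z.1 ->
  s (point i z) = dif (trans i (pchart (point i z))) z.1 a -> reps i s z = a.
Proof.
move=> iz e; have ok := overlap_point iz; rewrite repsE {}e.
by rewrite [LHS](dtrans_comp a ok (overlap_refl iz)) dtrans_id.
Qed.

Lemma repv_eq i X z w : cimg i z.1 ->
  X (point i z) = dif (ttrans i (pchart (point i z))) z w -> repv i X z = w.
Proof.
move=> iz e; have ok := overlap_point iz; rewrite repvE {}e.
by rewrite [LHS](dttrans_comp w ok (overlap_refl iz)) dttrans_id.
Qed.

Lemma repsK i s z : cimg i z.1 ->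
  dif (trans i (pchart (point i z))) z.1 (reps i s z) = s (point i z).
Proof.
by move=> iz; rewrite repsE; exact: (dtransK (s (point i z)) (overlap_point iz)).
Qed.

Lemma repvK i X z : cimg i z.1 ->
  dif (ttrans i (pchart (point i z))) z (repv i X z) = X (point i z).
Proof.
by move=> iz; rewrite repvE; exact: (dttransK (X (point i z)) (overlap_point iz)).
Qed.

Lemma reps_eta i z : cimg i z.1 -> reps i (@eta _ _ M) z = z.2.
Proof. by move=> iz; apply: reps_eq => //; rewrite /eta {1}point_eq. Qed.

Lemma repv_gamma i s z : cimg i z.1 -> repv i (gamma s) z = (0, reps i s z).
Proof.
move=> iz; apply: repv_eq => //.
by rewrite (dttrans_vert _ (overlap_point iz)) repsK.
Qed.

Lemma repv_rho i X z : cimg i z.1 -> (repv i X z).1 = reps i (rho X) z.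
Proof.
move=> iz; apply/esym/reps_eq => //.
by rewrite /rho -(repvK X iz) (dttrans1 _ (overlap_point iz)).
Qed.

Lemma near_chart u : \forall z \near coord u, cimg (pchart u) z.1.
Proof.
have o := overlap_near_fibre (overlap_refl (cimg_coord u)).
by apply: filterS o => z [].
Qed.

Lemma near_slit u : slit u ->
  \forall z \near coord u, cimg (pchart u) z.1 /\ slit (point (pchart u) z).
Proof.
move=> su; have su2 : (coord u).2 != 0 by exact: su.
have nz : \forall z \near coord u, z.2 != 0.
  exact: (near_snd (x := coord u) (near_neq0 su2)).
near=> z; have iz : cimg (pchart u) z.1 by near: z; exact: near_chart.
by split=> //; apply/slit_point => //; near: z.
Unshelve. all: by end_near. Qed.

Lemma smooths_near u s (f : E * E -> E) :
  (\forall z \near coord u, reps (pchart u) s z = f z) ->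
  smooth_near f (coord u) -> smooths s u.
Proof. by move=> e; apply: smooth_near_ext; apply: filterS e. Qed.

Lemma smooths_ext u s t :
  (\forall z \near coord u, s (point (pchart u) z) = t (point (pchart u) z)) ->
  smooths s u -> smooths t u.
Proof.
move=> e; apply: smooth_near_ext; apply: filterS e => z e.
by rewrite !repsE e.
Qed.

(** The first order part of [smooths]: unlike smoothness, it is transported to
nearby points by the chain rule of order one. *)
Definition differentiables s u := differentiable (reps (pchart u) s) (coord u).

Lemma smooths_differentiables u s : smooths s u -> differentiables s u.
Proof. by move=> /smooth_near_differentiable /nbhs_singleton. Qed.

Lemma smooths_eta u : smooths (@eta _ _ M) u.
Proof.
apply: (@smooths_near _ _ snd).
  by apply: filterS (near_chart u) => z iz; exact: reps_eta.
exact: (smooth_near_linear _ (@continuous_lsnd _ _ _)).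
Qed.

(** The section with constant components a in the chart i, over the domain of i. *)
Definition const_section i (a : E) : psection M :=
  fun v => dif (trans i (pchart v)) (cmap i v.1) a.

Lemma reps_const_section i a z : cimg i z.1 -> reps i (const_section i a) z = a.
Proof. by move=> iz; apply: reps_eq => //; rewrite /const_section /= cinvK. Qed.

Lemma const_section_fibre u (a y : E) : const_section (pchart u) a (u.1, y) = a.
Proof. by rewrite /const_section /= dtrans_id //; exact: (cimg_coord u). Qed.

Lemma const_sectionE u a : const_section (pchart u) a u = a.
Proof. by have := const_section_fibre u a u.2; case: u. Qed.

Lemma smooths_const_section u a : smooths (const_section (pchart u) a) u.
Proof.
apply: (@smooths_near _ _ (fun=> a)); last exact: smooth_near_cst.
by apply: filterS (near_chart u) => z iz; exact: reps_const_section.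
Qed.

Lemma reps0 i z : reps i (fun=> 0) z = 0.
Proof. by rewrite repsE linear0. Qed.

Lemma smooths0 u : smooths (fun=> 0 : E) u.
Proof.
apply: (@smooths_near _ _ (fun=> 0)); last exact: smooth_near_cst.
by apply: filterS (near_chart u) => z _; exact: reps0.
Qed.

Lemma smoothv_near u X (f : E * E -> (E * E)%type) :
  (\forall z \near coord u, repv (pchart u) X z = f z) ->
  smooth_near f (coord u) -> smoothv X u.
Proof. by move=> e; apply: smooth_near_ext; apply: filterS e. Qed.

Lemma smoothv_gamma u s : smooths s u -> smoothv (gamma s) u.
Proof.
move=> ss; apply: (@smoothv_near _ _ (fun z => linr E E (reps (pchart u) s z))).
  by apply: filterS (near_chart u) => z iz; rewrite repv_gamma.
by apply: (smooth_near_linear_comp _ ss); exact: continuous_linr.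
Qed.

(** The vector field on TM with local expression f in the natural chart of i. *)
Definition chart_vfield i (f : E * E -> (E * E)%type) : vfield M := fun v =>
  let c := ttrans (pchart v) i (coord v) in dif (ttrans i (pchart v)) c (f c).

Lemma chart_vfield_point i f z : cimg i z.1 ->
  chart_vfield i f (point i z) = dif (ttrans i (pchart (point i z))) z (f z).
Proof.
move=> iz; have ok := overlap_point iz; rewrite /chart_vfield /=.
by rewrite (coord_point iz) (ttrans_comp ok (overlap_refl iz)) ttrans_id.
Qed.

Lemma repv_chart_vfield i f z : cimg i z.1 -> repv i (chart_vfield i f) z = f z.
Proof. by move=> iz; apply: repv_eq => //; exact: chart_vfield_point. Qed.

Lemma smoothv_chart_vfield u f : smooth_near f (coord u) -> smoothv (chart_vfield (pchart u) f) u.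
Proof.
apply: smoothv_near.
by apply: filterS (near_chart u) => z iz; exact: repv_chart_vfield.
Qed.

(** The chart attached to a point near u need not be the one attached to u, hence a
change of charts. *)
Lemma differentiables_near u s : smooths s u ->
  \forall z \near coord u, differentiables s (point (pchart u) z).
Proof.
move=> /smooth_near_differentiable ds.
set i := pchart u in ds *.
near=> z; have iz : cimg i z.1 by near: z; exact: near_chart.
have dz : differentiable (reps i s) z by near: z.
have ok := overlap_point iz.
rewrite /differentiables (coord_point iz).
set j := pchart (point i z) in ok *.
have oji : overlap j i (ttrans i j z).1 := overlap_trans ok (overlap_refl iz).
have ezz : ttrans j i (ttrans i j z) = z.
  by rewrite (ttrans_comp ok (overlap_refl iz)) ttrans_id.
apply: (@near_eq_differentiable _ _ _
  (fun w => dif (trans i j) (ttrans j i w).1 (reps i s (ttrans j i w)))).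
  apply: filterS (overlap_near_fibre oji) => w oji'; apply/esym.
  have [jw iw] := oji'.
  have ojk := overlap_point jw.
  have pw : point i (ttrans j i w) = point j w by exact: point_ttrans.
  apply: reps_eq => //; rewrite -pw.
  rewrite -(repsK s (z := ttrans j i w)); last first.
    by case: (overlap_trans oji' oji').
  rewrite pw.
  have oik : overlap i (pchart (point j w)) (ttrans j i w).1 := overlap_trans oji' ojk.
  have oij : overlap i j (ttrans j i w).1 := overlap_trans oji' (overlap_refl jw).
  have {1}<- : trans i j (ttrans j i w).1 = w.1.
    by rewrite (trans_comp j oji') trans_id.
  by rewrite [RHS](dtrans_comp _ oij oik).
have dt := differentiable_ttrans oji.
apply: (@differentiable_comp _ _ _ _ (fun w => ((ttrans j i w).1, reps i s (ttrans j i w)))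
  (fun q : E * E => dif (trans i j) q.1 q.2)); last first.
  have oij : overlap i j (ttrans j i (ttrans i j z)).1 by rewrite ezz.
  by apply: differentiable_dtrans; exact: oij.
apply: differentiable_pair.
  apply: (@differentiable_comp _ _ _ _ (ttrans j i) fst) => //.
  exact: differentiable_fst.
have dz' : differentiable (reps i s) (ttrans j i (ttrans i j z)) by rewrite ezz.
exact: (@differentiable_comp _ _ _ _ (ttrans j i) (reps i s) _ dt dz').
Unshelve. all: by end_near. Qed.

End Sections.

(** * Connections: locality, horizontal lifts and torsion *)

Section Connections.
Context {R : realType} {n : nat} (M : manifold R n).
Local Notation E := ('rV[R]_n).
Local Notation TM := (TM M).
Local Notation eta := (@eta R n M).
Implicit Types (i j k : chart M) (u v : TM) (z : E * E) (s t r : psection M).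
Implicit Types (X Y : vfield M).

Context (nabla : conn M) (hconn : is_connection nabla).

Lemma vderiv_near_cst u (X : (E * E)%type) (f : TM -> R) (a : R) :
  (\forall z \near coord u, f (point (pchart u) z) = a) -> vderiv u X f = 0.
Proof.
move=> fa; rewrite /vderiv (near_eq_derive (g := cst a)) ?derive_cst //.
Qed.

(** Leibniz' rule with the indicator function f of the set where s and t agree:
f s = f t everywhere, while f is constant near u. *)
Lemma conn_local u (X : (E * E)%type) s t : slit u -> smooths s u -> smooths t u ->
  (\forall z \near coord u, s (point (pchart u) z) = t (point (pchart u) z)) ->
  nabla u X s = nabla u X t.
Proof.
move=> su ss st e; pose f v : R := if `[< s v = t v >] then 1 else 0.
have f1 : \forall z \near coord u, f (point (pchart u) z) = 1.
  by apply: filterS e => z e; rewrite /f asboolT.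
have fu : f u = 1 by have := nbhs_singleton f1; rewrite point_coord.
have sf : smoothf f u.
  have s1 : smooth_near (fun _ : (E * E)%type => 1 : R) (coord u).
    exact: smooth_near_cst.
  by apply: smooth_near_ext s1; apply: filterS f1 => z e1; rewrite /repf e1.
have d0 := vderiv_near_cst X f1.
have := conn_leibniz hconn su sf ss X; rewrite d0 fu scale0r add0r scale1r => <-.
have := conn_leibniz hconn su sf st X; rewrite d0 fu scale0r add0r scale1r => <-.
congr nabla; apply/funext => v; rewrite /f.
by case: asboolP => [->//|_]; rewrite !scale0r.
Qed.

Lemma conn_zero u (X : (E * E)%type) s : slit u ->
  (\forall z \near coord u, s (point (pchart u) z) = 0) -> nabla u X s = 0.
Proof.
move=> su s0; have s0' := smooths0 u.
have -> : nabla u X s = nabla u X (fun=> 0).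
  apply: conn_local => //; apply: smooths_ext s0'.
  by apply: filterS s0.
have /(congr1 (fun y => y - nabla u X (fun=> 0))) := conn_additive hconn su s0' s0' X.
rewrite addrK (_ : (fun _ => _) = (fun=> 0)) ?subrr //.
by apply/funext => v; rewrite addr0.
Qed.

(** As gamma s projects to 0, only the derivative of rho X survives in the first
component of the bracket.  Both local expressions have to be differentiable,
for otherwise the bracket is an arbitrary value. *)
Lemma torsion_gamma u s X : slit u -> differentiables s u ->
  differentiable (repv (pchart u) X) (coord u) ->
  torsion nabla (gamma s) X u =
  nabla u (0, s u) (rho X) -
  'D_((0, s u) : (E * E)%type) (reps (pchart u) (rho X)) (coord u).
Proof.
move=> su ds dX; rewrite /torsion.
rewrite (conn_zero (s := rho (gamma s)) _ su); last by apply: filterS (near_chart u).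
rewrite subr0; congr (_ - _).
have dg : differentiable (repv (pchart u) (gamma s)) (coord u).
  apply: (@near_eq_differentiable _ _ _ (fun z => linr E E (reps (pchart u) s z))).
    by apply: filterS (near_chart u) => z iz; rewrite repv_gamma.
  by apply: (differentiable_linear_comp _ ds); exact: continuous_linr.
have e1 (w : (E * E)%type) : ('D_w (repv (pchart u) X) (coord u)).1 =
    'D_w (reps (pchart u) (rho X)) (coord u).
  apply: etrans (derive_pair_fst w dX) (near_eq_derive w _).
  by apply: filterS (near_chart u) => z iz; rewrite repv_rho.
have e2 (w : (E * E)%type) : ('D_w (repv (pchart u) (gamma s)) (coord u)).1 = 0.
  apply: etrans (derive_pair_fst w dg) (etrans _ (derive_cst 0 (coord u) w)).
  apply: near_eq_derive.
  by apply: filterS (near_chart u) => z iz; rewrite repv_gamma.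
rewrite -[LHS]/(('D_((0, s u) : (E * E)%type) (repv (pchart u) X) (coord u)).1 -
  ('D_(X u) (repv (pchart u) (gamma s)) (coord u)).1).
by rewrite [X in X - _]e1 [X in _ - X]e2 subr0.
Qed.

Context (hreg : regular nabla).

Lemma beta_spec u s : slit u ->
  horizontal nabla u (beta nabla s u) /\ (beta nabla s u).1 = s u.
Proof.
move=> su; rewrite /beta; set P := [set X | _].
apply: (@xgetPex _ 0 P).
have [V [H [vV hH e]]] := (hreg su).1 (s u, 0).
by exists H; split=> //; move/(congr1 fst): e; rewrite /= vV add0r.
Qed.

Lemma beta_uniq u s (X : (E * E)%type) : slit u ->
  horizontal nabla u X -> X.1 = s u -> beta nabla s u = X.
Proof.
move=> su hX eX; have [hb eb] := beta_spec s su.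
apply/eqP; rewrite -subr_eq0; apply/eqP; apply: (hreg su).2.
  by rewrite /vertical /= eb eX subrr.
rewrite /horizontal addrC -scaleN1r (conn_linear hconn) //; last exact: smooths_eta.
by rewrite hb hX scaler0 addr0.
Qed.

Lemma rho_beta u s : slit u -> rho (beta nabla s) u = s u.
Proof. by move=> su; have [_] := beta_spec s su. Qed.

(** The local expression of the deflection map X |-> nabla_X eta, on the vector with
fixed components w. *)
Let K i (w : (E * E)%type) : E * E -> E :=
  reps i (fun v => nabla v (chart_vfield i (fun=> w) v) eta).

Lemma connKE i z w : cimg i z.1 -> K i w z =
  dif (trans (pchart (point i z)) i) (coord (point i z)).1
    (nabla (point i z) (dif (ttrans i (pchart (point i z))) z w) eta).
Proof. by move=> iz; rewrite /K repsE chart_vfield_point. Qed.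

Lemma connK_linear i z : cimg i z.1 -> slit (point i z) -> linear (K i ^~ z).
Proof.
move=> iz sz a w w'; rewrite !connKE // linearP (conn_linear hconn) //.
  by rewrite linearP.
exact: smooths_eta.
Qed.

Lemma connK_eq0 i z w : cimg i z.1 -> K i w z = 0 ->
  horizontal nabla (point i z) (dif (ttrans i (pchart (point i z))) z w).
Proof.
move=> iz; rewrite connKE // /horizontal; set y := nabla _ _ _ => e.
have ok := overlap_point iz; have := dtransK y ok.
by rewrite [X in dif _ _ X]e linear0.
Qed.

Lemma connK_differentiable u w : slit u ->
  differentiable (K (pchart u) w) (coord u).
Proof.
move=> su; apply: smooths_differentiables.
apply: (conn_smooth hconn) => //; last exact: smooths_eta.
by apply: smoothv_chart_vfield; exact: smooth_near_cst.
Qed.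

(** The vertical and horizontal parts of the deflection map in the natural chart. *)
Let B i z : 'M[R]_n := \matrix_k K i (0, delta_mx 0 k) z.
Let A i z (a : E) : E := \sum_k a 0 k *: K i (delta_mx 0 k, 0) z.

Lemma connK_split i z (a b : E) : cimg i z.1 -> slit (point i z) ->
  K i (a, b) z = A i z a + b *m B i z.
Proof.
move=> iz sz; have lin := connK_linear iz sz.
pose L : {linear (E * E)%type -> E} :=
  HB.pack (K i ^~ z) (GRing.isLinear.Build _ _ _ _ _ lin).
have -> : K i (a, b) z = L (a, b) by [].
have -> : (a, b) = \sum_k a 0 k *: ((delta_mx 0 k : E), (0 : E)) +
    \sum_k b 0 k *: ((0 : E), (delta_mx 0 k : E)).
  have -> : \sum_k a 0 k *: ((delta_mx 0 k : E), (0 : E)) = (a, 0).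
    rewrite {2}(row_sum_delta a).
    elim/big_ind2: _ => // [x1 x2 y1 y2 -> ->|k _]; first by congr pair; rewrite addr0.
    by congr pair; rewrite scaler0.
  have -> : \sum_k b 0 k *: ((0 : E), (delta_mx 0 k : E)) = (0, b).
    rewrite {2}(row_sum_delta b).
    elim/big_ind2: _ => // [x1 x2 y1 y2 -> ->|k _]; first by congr pair; rewrite addr0.
    by congr pair; rewrite scaler0.
  by congr pair; rewrite ?addr0 ?add0r.
rewrite linearD !linear_sum; congr (_ + _); first by apply: eq_bigr => k _; rewrite linearZ.
rewrite mulmx_sum_row; apply: eq_bigr => k _.
by rewrite linearZ /= rowK.
Qed.

(** Were w B = 0 for some nonzero w, the vertical vector (0, w) would be horizontal. *)
Lemma unitmx_connK i z : cimg i z.1 -> slit (point i z) -> B i z \in unitmx.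
Proof.
move=> iz sz; rewrite -row_free_unit; apply: inj_row_free => w w0.
have ok := overlap_point iz.
have Kw : K i (0, w) z = 0.
  by rewrite connK_split // w0 addr0 /A big1 // => k _; rewrite mxE scale0r.
have := connK_eq0 iz Kw; rewrite (dttrans_vert w ok) => hw.
have /(congr1 snd) /= e := (hreg sz).2 (0, _) erefl hw.
have := dtrans_comp w ok (overlap_refl iz).
by rewrite [X in dif _ _ X]e linear0 dtrans_id.
Qed.

Lemma repv_beta i t z : cimg i z.1 -> slit (point i z) ->
  repv i (beta nabla t) z =
  (reps i t z, - (A i z (reps i t z)) *m invmx (B i z)).
Proof.
move=> iz sz; have ok := overlap_point iz; apply: repv_eq => //.
apply: beta_uniq => //; last by rewrite (dttrans1 _ ok) repsK.
apply: connK_eq0 => //.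
by rewrite connK_split // mulmxKV ?subrr // unitmx_connK.
Qed.

(** The horizontal vector over a is (a, w), where w solves the linear system
A a + w B = 0; Cramer's rule makes w depend differentiably on the point. *)
Lemma beta_differentiable u t : slit u -> smooths t u ->
  differentiable (repv (pchart u) (beta nabla t)) (coord u).
Proof.
move=> su st; have dt : differentiable _ _ := smooths_differentiables st.
apply: (@near_eq_differentiable _ _ _ (fun z => (reps (pchart u) t z,
  - (A (pchart u) z (reps (pchart u) t z)) *m invmx (B (pchart u) z)))).
  by apply: filterS (near_slit su) => z [iz sz]; rewrite repv_beta.
apply: differentiable_pair => //.
apply: differentiable_mulmx.
  apply: differentiableN; apply: differentiable_bigsum => k _.
  apply: differentiable_scale; last exact: connK_differentiable.
  exact: differentiable_coordE.
apply: differentiable_invmx.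
  by apply: filterS (near_slit su) => z [iz sz]; exact: unitmx_connK.
apply: differentiable_mx => k l; under eq_fun do rewrite mxE.
by apply: differentiable_coordE; exact: connK_differentiable.
Qed.

(** The horizontal lift enters only through its projection t. *)
Lemma mixed_torsionE u s t : slit u -> differentiables s u -> smooths t u ->
  mixed_torsion nabla s t u =
  nabla u (0, s u) t - 'D_((0, s u) : (E * E)%type) (reps (pchart u) t) (coord u).
Proof.
move=> su ds st.
have e : \forall z \near coord u, t (point (pchart u) z) =
    rho (beta nabla t) (point (pchart u) z).
  by apply: filterS (near_slit su) => z [iz sz]; rewrite rho_beta.
have db := beta_differentiable su st.
rewrite /mixed_torsion [LHS](torsion_gamma su ds db); congr (_ - _).
  by apply/esym/conn_local => //; exact: smooths_ext st.
by apply/esym/near_eq_derive; apply: filterS e => z e; rewrite !repsE e.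
Qed.

End Connections.

(** * The Finsler metric on a fibre *)

Section Finsler.
Context {R : realType} {n : nat} (M : manifold R n).
Local Notation E := ('rV[R]_n).
Local Notation TM := (TM M).
Local Notation eta := (@eta R n M).
Implicit Types (u v : TM) (s t r : psection M).

Context (L : TM -> R) (hL : is_finsler L).

Definition energy (p : M) (y : E) : R := L (p, y) ^+ 2.

(** The fibre over p is an affine subspace of the natural chart at (p, y). *)
Lemma energy_smooth p y : y != 0 -> smooth_near (energy p) y.
Proof.
move=> y0; pose u : TM := (p, y).
have [A [oA Ay] sA] := finsler_smooth hL (y0 : slit u).
pose x := (coord u).1; pose l := linr E E.
have eA y' : (x, 0 : E) + l y' = (x, y').
  have e1 : x + 0 = x by rewrite addr0.
  have e2 : 0 + y' = y' by rewrite add0r.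
  by rewrite -[in RHS]e1 -[in RHS]e2.
have oB : open [set y' | A ((x, 0 : E) + l y')].
  apply: (@open_comp _ _ (fun y' => (x, 0 : E) + l y')) oA => y' _.
  apply: (@continuousD _ _ _ (cst _) l); first exact: cst_continuous.
  exact: continuous_linr.
exists [set y' | A ((x, 0 : E) + l y')]; first by split=> //; rewrite /= eA.
move=> k; have sL : Ck_on k [set y' | A ((x, 0 : E) + l y')] (fun y' => L (p, y')).
  rewrite (_ : (fun y' => _) = fun y' => repf (pchart u) L ((x, 0) + l y')).
    by apply: (@Ck_on_affine _ _ _ _ _ _ A) (sA k) => //; exact: continuous_linr.
  by apply/funext => y'; rewrite eA /repf point_pchart.
by apply: Ck_on_ext (Ck_on_mul oB sL sL).
Qed.

Lemma differentiable_energy p y : y != 0 -> differentiable (energy p) y.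
Proof.
by move=> /(energy_smooth p) [A [oA Ay] sA]; have [+ _] := sA 1%N; apply.
Qed.

Lemma differentiable_denergy p y a : y != 0 -> differentiable (fun z => 'D_a (energy p) z : R) y.
Proof.
by move=> /(energy_smooth p) [A [oA Ay] sA]; have [_ /(_ a)[+ _]] := sA 2%N; apply.
Qed.

Lemma differentiable_ddenergy p y a b : y != 0 ->
  differentiable (fun z => 'D_b (fun z' => 'D_a (energy p) z' : R) z : R) y.
Proof.
move=> /(energy_smooth p) [A [oA Ay] sA].
by have [_ /(_ a)[_ /(_ b)[+ _]]] := sA 3%N; apply.
Qed.

Lemma energy_homog p y a : y != 0 -> 0 < a ->
  energy p (a *: y) = a ^+ 2 * energy p y.
Proof. by move=> y0 a0; rewrite /energy (finsler_homogeneous hL) // exprMn. Qed.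

(** Differentiate F(a y) = a^2 F(y) in the direction c: both sides carry a factor
a. *)
Lemma denergy_homog p y c a : y != 0 -> 0 < a ->
  'D_c (energy p) (a *: y) = a * 'D_c (energy p) y.
Proof.
move=> y0 a0; have ay0 : a *: y != 0 by rewrite scaler_eq0 gt_eqF.
have e : 'D_c (fun z => energy p (0 + a *: z)) y = a *: 'D_c (energy p) (a *: y).
  rewrite (derive_affine (energy p) 0 (( *:%R a) : {linear E -> E})) /= add0r.
  exact: derive_scale_dir (differentiable_energy p ay0).
have e' : 'D_c (fun z => energy p (0 + a *: z)) y = a ^+ 2 *: 'D_c (energy p) y.
  rewrite (near_eq_derive (g := a ^+ 2 \*: energy p)).
    by rewrite deriveZ //; apply: diff_derivable; exact: differentiable_energy.
  by apply: filterS (near_neq0 y0) => z z0; rewrite add0r energy_homog.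
apply: (mulfI (lt0r_neq0 a0)); apply: etrans (esym e) (etrans e' _).
by rewrite expr2 -scalerA.
Qed.

Lemma metricE u (b w : E) :
  metric L u b w = 2^-1 * 'D_b (fun z => 'D_w (energy u.1) z) u.2.
Proof. by []. Qed.

(** D_c F is homogeneous of degree 1. *)
Lemma metric_etal u c : slit u -> metric L u u.2 c = 2^-1 * 'D_c (energy u.1) u.2.
Proof. by move=> y0; rewrite metricE euler1 // => a a0; exact: denergy_homog. Qed.

(** Together with [metric_etal] this is the symmetry of g on pairs containing y,
obtained without exchanging second derivatives.  With z = y + h c, the relation
D_z F(z) = 2 F(z) gives D_y F(z) = 2 F(z) - h D_c F(z), which is then
differentiated at h = 0. *)
Lemma metric_etar u c : slit u -> metric L u c u.2 = 2^-1 * 'D_c (energy u.1) u.2.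
Proof.
case: u => p y su; have y0 : y != 0 by exact: su.
rewrite metricE /=; congr (_ * _).
pose l (h : R) := y + h *: c.
have l0 : l 0 = y by rewrite /l scale0r addr0.
have dl : differentiable l 0.
  by apply: (@differentiableD _ _ _ (cst y) (fun h : R => h *: c)).
have y0' : l 0 != 0 by rewrite l0.
have nl : \forall h \near (0 : R), l h != 0.
  exact: (differentiable_continuous dl (near_neq0 y0')).
pose F1 h := energy p (l h); pose F2 h : R := 'D_c (energy p) (l h).
have i1 : is_derive (0 : R) 1 F1 ('D_c (energy p) y).
  have d1 : differentiable F1 0.
    exact: (@differentiable_comp _ _ _ _ l (energy p) _ dl (differentiable_energy p y0')).
  by apply: DeriveDef; [exact: diff_derivable|exact: esym (derive_line _ _ _)].
have i2 : is_derive (0 : R) 1 F2 ('D_1 F2 0).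
  have d2 : differentiable F2 0.
    exact: (@differentiable_comp _ _ _ _ l (fun z => 'D_c (energy p) z : R) _ dl
      (differentiable_denergy p c y0')).
  by apply: DeriveDef => //; exact: diff_derivable.
rewrite derive_line (near_eq_derive (g := 2 \*: F1 - id * F2)).
  rewrite derive_val /= {2}/F2 l0.
  by rewrite scale0r add0r /GRing.scale /= mulr1 mulr_natl mulr2n addrK.
apply: filterS nl => h lh; have dh := differentiable_energy p lh.
have e2 : 'D_(l h) (energy p) (l h) = 2 * energy p (l h).
  by apply: euler2 => a a0; exact: energy_homog.
have ey : y = l h - h *: c by rewrite /l addrK.
rewrite -[RHS]/(2 * energy p (l h) - h * 'D_c (energy p) (l h)) -e2.
rewrite -[LHS]/('D_y (energy p) (l h)) !(deriveE_dif _ dh).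
apply: etrans (congr1 (dif (energy p) (l h)) ey) _.
by rewrite linearB linearZ.
Qed.

Lemma metricDl u (b b' w : E) : slit u ->
  metric L u (b + b') w = metric L u b w + metric L u b' w.
Proof.
move=> su; rewrite !metricE !(deriveE_dif _ (differentiable_denergy _ w su)).
by rewrite linearD mulrDr.
Qed.

Lemma metric0l u w : metric L u 0 w = 0.
Proof. by rewrite metricE derive0 mulr0. Qed.

Lemma metric0r u w : metric L u w 0 = 0.
Proof.
rewrite metricE; have -> : (fun z => 'D_0 (energy u.1) z) = cst 0.
  by apply/funext => z; rewrite derive0.
by rewrite derive_cst mulr0.
Qed.

Lemma vderiv_vert u a (f : TM -> R) :
  vderiv u (0, a) f = 'D_a (fun y => f (u.1, y)) u.2.
Proof.
rewrite /vderiv derive_vert; congr ('D_a _ _).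
by apply/funext => y; rewrite /repf point_pchart.
Qed.

End Finsler.

(** * The mixed torsion of the Cartan connection *)

Section Cartan.
Context {R : realType} {n : nat} (M : manifold R n).
Local Notation E := ('rV[R]_n).
Local Notation TM := (TM M).
Local Notation eta := (@eta R n M).
Implicit Types (u v : TM) (s t r : psection M).

Lemma derive_reps_eta u (b : E) :
  'D_((0, b) : (E * E)%type) (reps (pchart u) eta) (coord u) = b.
Proof.
rewrite (near_eq_derive (g := snd)); last first.
  by apply: filterS (near_chart u) => z iz; rewrite reps_eta.
by rewrite derive_vert /= derive_id.
Qed.

Lemma derive_reps_const_section u a (X : (E * E)%type) :
  'D_X (reps (pchart u) (const_section (pchart u) a)) (coord u) = 0.
Proof.
rewrite (near_eq_derive (g := cst a)) ?derive_cst //.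
by apply: filterS (near_chart u) => z iz; rewrite reps_const_section.
Qed.

Lemma eq_sections i s t z : cimg i z.1 -> reps i s z = reps i t z ->
  s (point i z) = t (point i z).
Proof. by move=> iz e; rewrite -[LHS](repsK s iz) -[RHS](repsK t iz) e. Qed.

Context (L : TM -> R) (nabla : conn M).
Context (hL : is_finsler L) (hC : is_cartan L nabla).
Let hconn := cartan_connection hC.
Let hreg := cartan_regular hC.
Local Notation T := (mixed_torsion nabla).

Lemma differentiables_const_section u a : differentiables (const_section (pchart u) a) u.
Proof. by apply: smooths_differentiables; exact: smooths_const_section. Qed.

Lemma mixed_torsion_const_section u a c : slit u ->
  T (const_section (pchart u) a) (const_section (pchart u) c) u = nabla u (0, a) (const_section (pchart u) c).
Proof.
move=> su.
rewrite [LHS](mixed_torsionE hconn hreg su (differentiables_const_section u a) (smooths_const_section u c)).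
by rewrite const_sectionE derive_reps_const_section subr0.
Qed.

Lemma mixed_torsion_etaE u s : slit u -> differentiables s u ->
  T s eta u = nabla u (0, s u) eta - s u.
Proof.
move=> su ds.
by rewrite [LHS](mixed_torsionE hconn hreg su ds (smooths_eta u)) derive_reps_eta.
Qed.

(** Let theta = nabla_a eta - a = T(a, eta) and tau = T(a, c).  Metricity for eta
and the constant section c reads g(a, c) = g(theta + a, c) + g(y, tau), while
g(y, tau) = g(tau, y) = g(theta, c) by the symmetry of T.  Hence g(theta, c) = 0
for every c, in particular for c = theta. *)
Lemma cartan_vert_eta u a : slit u -> nabla u (0, a) eta = a.
Proof.
move=> su; set i := pchart u; pose p := u.1; pose y := u.2.
have da := differentiables_const_section u a.
pose th := nabla u (0, a) eta - a.
have thE : T (const_section i a) eta u = th.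
  by rewrite [LHS](mixed_torsion_etaE su da) const_sectionE.
suff : th = 0 by move/eqP; rewrite subr_eq0 => /eqP.
suff H c : metric L u th c = 0.
  apply/eqP/negP => /negP th0.
  by have := finsler_posdef hL su th0; rewrite H ltxx.
pose tau := nabla u (0, a) (const_section i c).
have tauE : T (const_section i a) (const_section i c) u = tau by exact: mixed_torsion_const_section.
have h1 := cartan_T hC su (smooths_const_section u a) (smooths_const_section u c) (smooths_eta u).
have {}h1 : metric L u tau y = metric L u th c.
  by move: h1; rewrite tauE thE const_sectionE.
have h2 := cartan_metric hC su (smooths_eta u) (smooths_const_section u c) (0, a).
have h3 : vderiv u (0, a) (fun v => metric L v (eta v) (const_section i c v)) = metric L u a c.
  rewrite vderiv_vert.
  have e : \forall z \near u.2, metric L (p, z) z (const_section i c (p, z)) =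
      (2^-1 \*: (fun x => 'D_c (energy L p) x : R)) z.
    apply: filterS (near_neq0 su) => z z0; rewrite const_section_fibre.
    exact: (metric_etal hL c (u := (p, z)) z0).
  apply: etrans (near_eq_derive a e) _; rewrite deriveZ; last first.
    by apply: diff_derivable; exact: differentiable_denergy.
  exact: esym (metricE L u a c).
have h4 : metric L u (nabla u (0, a) eta) c = metric L u th c + metric L u a c.
  have -> : nabla u (0, a) eta = th + a by rewrite subrK.
  exact: (metricDl hL th a c su).
have h5 : metric L u y tau = metric L u tau y.
  exact: etrans (metric_etal hL tau su) (esym (metric_etar hL tau su)).
have h6 : metric L u a c = metric L u th c + metric L u a c + metric L u th c.
  rewrite -{1}h3 -h4 -h1 -h5 h2 const_sectionE; congr (_ + _).
move: (metric L u th c) (metric L u a c) h6 => x w; rewrite addrAC => e.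
have : x + x = 0 by apply: (addIr w); rewrite add0r -e.
by rewrite -mulr2n => /eqP; rewrite mulrn_eq0 => /eqP.
Qed.

Lemma mixed_torsion_eta u s : slit u -> differentiables s u -> T s eta u = 0.
Proof. by move=> su ds; rewrite mixed_torsion_etaE // cartan_vert_eta // subrr. Qed.

Lemma mixed_torsion_local u s t t' : slit u -> differentiables s u ->
  smooths t u -> smooths t' u ->
  (\forall z \near coord u, t (point (pchart u) z) = t' (point (pchart u) z)) ->
  T s t u = T s t' u.
Proof.
move=> su ds st st' e.
rewrite [LHS](mixed_torsionE hconn hreg su ds st).
rewrite [RHS](mixed_torsionE hconn hreg su ds st').
congr (_ - _); first exact: conn_local.
by apply: near_eq_derive; apply: filterS e => z e; rewrite !repsE e.
Qed.

Section Riemannian.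
Context (T0 : forall u, slit u -> forall s t, smooths s u -> smooths t u ->
  T s t u = 0).

(** Constant sections b and c are parallel in the vertical directions when T = 0, so
that metricity leaves no derivative of g(b, c). *)
Lemma dmetric0 p (y a b c : E) : y != 0 ->
  'D_a (fun z => metric L (p, z) b c) y = 0.
Proof.
move=> y0; pose u : TM := (p, y); have su : slit u by exact: y0.
have z0 b' : nabla u (0, a) (const_section (pchart u) b') = 0.
  rewrite -[LHS](mixed_torsion_const_section _ _ su).
  by apply: T0 => //; exact: smooths_const_section.
have e : vderiv u (0, a) (fun v => metric L v (const_section (pchart u) b v)
    (const_section (pchart u) c v)) = 'D_a (fun z => metric L (p, z) b c) y.
  rewrite vderiv_vert; apply: near_eq_derive.
  by apply: filterS (near_neq0 y0) => z _; rewrite !const_section_fibre.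
have e' := cartan_metric hC su (smooths_const_section u b) (smooths_const_section u c) (0, a).
have m1 w : metric L u (nabla u (0, a) (const_section (pchart u) b)) w = 0.
  by rewrite z0 metric0l.
have m2 w : metric L u w (nabla u (0, a) (const_section (pchart u) c)) = 0.
  by rewrite z0 metric0r.
rewrite (m1 _) (m2 _) addr0 in e'.
by rewrite -e; exact: e'.
Qed.

Lemma metric_segment p (y y' b c : E) :
  (forall a : R, a \in `[0, 1]%R -> y + a *: (y' - y) != 0) ->
  metric L (p, y) b c = metric L (p, y') b c.
Proof.
move=> nz; pose f (h : R) := metric L (p, y + h *: (y' - y)) b c.
have df (x : R) : x \in `[0, 1]%R -> differentiable f x.
  move=> xI; pose l (h : R) := y + h *: (y' - y).
  have dl : differentiable l x.
    by apply: (@differentiableD _ _ _ (cst y) (fun h : R => h *: (y' - y))).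
  have dg : differentiable (fun z => metric L (p, z) b c) (l x).
    apply: (differentiableZ 2^-1 (differentiable_ddenergy hL p c b (nz _ xI))).
  exact: (@differentiable_comp _ _ _ _ l (fun z => metric L (p, z) b c) _ dl dg).
have [||x xI] := @MVT_segment R f (fun=> 0) 0 1 ler01.
- move=> x /subset_itv_oo_cc xI; apply: DeriveDef.
    by apply: diff_derivable; exact: df.
  apply: etrans (derive_along_line (fun z => metric L (p, z) b c) y (y' - y) x) _.
  by apply: dmetric0; exact: nz.
- by apply: continuous_in_subspaceT => x /set_mem xI; exact/differentiable_continuous/df.
- rewrite mul0r => /subr0_eq e.
  have e0 : y + 0 *: (y' - y) = y by rewrite scale0r addr0.
  have e1 : y + 1 *: (y' - y) = y' by rewrite scale1r addrC subrK.
  by move: e; rewrite /f e0 e1 => ->.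
Qed.

(** The segment from y to the l-th basis vector avoids 0: its k-th coordinate
vanishes only at the end, where the l-th one is 1. *)
Lemma metric_basis p (y b c : E) k l : y 0 k != 0 -> l != k ->
  metric L (p, y) b c = metric L (p, delta_mx 0 l) b c.
Proof.
move=> yk lk; apply: metric_segment => a _; apply/negP => /eqP e.
have ek : (1 - a) * y 0 k = 0.
  have := congr1 (fun q : E => q 0 k) e; rewrite !mxE eqxx (eq_sym k) (negbTE lk).
  by rewrite /= sub0r mulrN mulrBl mul1r.
have a1 : a = 1.
  by move/eqP: ek; rewrite mulf_eq0 (negbTE yk) orbF subr_eq0 => /eqP.
have := congr1 (fun q : E => q 0 l) e; rewrite !mxE !eqxx a1 mul1r addrCA subrr addr0.
by move/eqP; rewrite oner_eq0.
Qed.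

(** Basis vectors are used as intermediate points, which spares a separate case for
opposite vectors; a second index exists because the dimension is at least 2. *)
Lemma riemannian_of_mixed_torsion0 : riemannian L nabla.
Proof.
split; first exact: T0.
move=> n1 p y y' y0 y'0; apply/funext => b; apply/funext => c.
have [k yk] : exists k, y 0 k != 0 by apply/rV0Pn.
have [k' yk'] : exists k, y' 0 k != 0 by apply/rV0Pn.
have other (j : 'I_n) : exists l : 'I_n, l != j.
  apply/existsP; apply: contraR n1; rewrite negb_exists => /forallP j1.
  rewrite -(card_ord n) -(card1 j); apply/eqP/eq_card => l.
  by have := j1 l; rewrite negbK => /eqP ->; rewrite !inE eqxx.
have [l lk] := other k; have [l' lk'] := other k'.
rewrite (metric_basis p b c yk lk) (metric_basis p b c yk' lk').
have [->//|ll] := eqVneq l' l; apply: metric_basis ll.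
by rewrite mxE !eqxx oner_eq0.
Qed.

End Riemannian.
End Cartan.

(** * Recurrence of the mixed torsion *)

Section Recurrence.
Context {R : realType} {n : nat} (M : manifold R n).
Local Notation E := ('rV[R]_n).
Local Notation TM := (TM M).
Local Notation eta := (@eta R n M).
Context (L : TM -> R) (nabla : conn M).
Context (hL : is_finsler L) (hC : is_cartan L nabla).

(** Recurrence evaluated at (t, s, eta): of the three terms of D_{gamma t} T only
T(s, D_{gamma t} eta) = T(s, t) can be nonzero, because T( . , eta) vanishes on a
whole neighbourhood of u and not only at u. *)
Lemma recurrent_mixed_torsion0 (D : conn M) : is_connection D ->
  (forall u, slit u -> forall b, D u (0, b) eta = b) ->
  recurrent D (mixed_torsion nabla) ->
  forall u, slit u -> forall s t, smooths s u -> smooths t u ->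
    mixed_torsion nabla s t u = 0.
Proof.
move=> hD Deta [lam _ rec] u su s t ss st.
pose T := mixed_torsion nabla.
have se := smooths_eta u.
have := rec u su t s eta st ss se; rewrite /cov_tensor.
have ds := smooths_differentiables ss.
have Tse0 : T s eta u = 0 := mixed_torsion_eta hL hC su ds.
have e1 : D u (gamma t u) (T s eta) = 0.
  apply: conn_zero => //; near=> z.
  have [iz sz] : cimg (pchart u) z.1 /\ slit (point (pchart u) z).
    by near: z; exact: near_slit.
  apply: (mixed_torsion_eta hL hC sz).
  by near: z; exact: differentiables_near.
have e2 : T (fun v => D v (gamma t v) s) eta u = 0.
  apply: (mixed_torsion_eta hL hC su); apply: smooths_differentiables.
  by apply: (conn_smooth hD) => //; exact: smoothv_gamma.
have near_t : \forall z \near coord u, t (point (pchart u) z) =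
    D (point (pchart u) z) (gamma t (point (pchart u) z)) eta.
  by apply: filterS (near_slit su) => z [iz sz]; rewrite Deta.
have e3 : T s t u = T s (fun v => D v (gamma t v) eta) u.
  exact: (mixed_torsion_local hC su ds st (smooths_ext near_t st) near_t).
rewrite -[X in X - _ - _]/(D u (gamma t u) (T s eta)) e1.
rewrite -[X in _ - X - _]/(T (fun v => D v (gamma t v) s) eta u) e2.
rewrite -[X in _ - X = _]/(T s (fun v => D v (gamma t v) eta) u) -e3.
rewrite -[X in _ = _ *: X]/(T s eta u) Tse0 scaler0 subr0 sub0r.
by move/eqP; rewrite oppr_eq0 => /eqP.
Unshelve. all: by end_near. Qed.

(** The test field Y has local expression (x, y) |-> (y, 0), thus rho Y = eta near u,
and the torsion of D on (gamma b, Y) is D_{(0, b)} eta - b. *)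
Lemma berwald_vert_eta (D : conn M) u b : is_berwald nabla D -> slit u ->
  D u (0, b) eta = b.
Proof.
move=> hB su; pose i := pchart u; pose Y := chart_vfield i (lspray E).
have hD := berwald_connection hB.
have sY : smooth_near (lspray E) (coord u).
  by apply: smooth_near_linear; exact: continuous_lspray.
have vY : smoothv Y u := smoothv_chart_vfield sY.
have dY : differentiable (repv i Y) (coord u).
  exact: nbhs_singleton (smooth_near_differentiable vY).
have nY : \forall z \near coord u, reps i eta z = reps i (rho Y) z.
  apply: filterS (near_chart u) => z iz.
  by rewrite reps_eta // -repv_rho // repv_chart_vfield.
have nY' : \forall z \near coord u, eta (point i z) = rho Y (point i z).
  by near=> z; apply: eq_sections; near: z; [exact: near_chart|].
have se := smooths_eta u.
have := berwald_torsion hB su (smoothv_gamma (smooths_const_section u b)) vY.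
rewrite (torsion_gamma hD su (differentiables_const_section u b) dY) const_sectionE => /subr0_eq e.
rewrite (conn_local hD (0, b) su se (smooths_ext nY' se) nY') e.
apply: etrans (derive_reps_eta u b); apply: near_eq_derive.
by apply: filterS nY.
Unshelve. all: by end_near. Qed.

End Recurrence.

Theorem theorem3p28 (R : realType) (n : nat) (M : manifold R n)
    (L : TM M -> R) (nabla : conn M)
    (hL : is_finsler L) (hnabla : is_cartan L nabla) :
  (Cv_recurrent nabla -> riemannian L nabla) /\
  (forall D : conn M, is_berwald nabla D ->
     C0_recurrent nabla D -> riemannian L nabla).
Proof.
split=> [rec|D hD rec]; apply: (riemannian_of_mixed_torsion0 hL hnabla).
  apply: (recurrent_mixed_torsion0 hL hnabla _ _ rec).
    exact: cartan_connection hnabla.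
  by move=> u su b; exact: (cartan_vert_eta hL hnabla).
apply: (recurrent_mixed_torsion0 hL hnabla _ _ rec).
  exact: berwald_connection hD.
by move=> u su b; exact: (berwald_vert_eta b hD su).
Qed.
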